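(* Let $n\geq 1$, let $\mathbf{c}=(c_1,\dots,c_n)\in\mathbb{Z}_{>0}^n$ and let $k$ be an integer with $0<k<c_1+\cdots+c_n$. Then the polytope $\mathscr{R}_{k,\mathbf{c}}$ is Ehrhart positive: its Ehrhart polynomial $\operatorname{ehr}(\mathscr{R}_{k,\mathbf{c}},t)$, which has degree $n-1$, has all of its coefficients (of $t^0,t^1,\dots,t^{n-1}$) positive.
   Context: For $\mathbf{c}=(c_1,\dots,c_n)\in\mathbb{Z}_{>0}^n$ and $k\in\mathbb{Z}_{>0}$, the slice of prism is $\mathscr{R}_{k,\mathbf{c}}=\{x\in\mathbb{R}^n : 0\le x_i\le c_i \text{ for all } i,\ \sum_{i=1}^n x_i=k\}$; it is a lattice polytope. For a lattice polytope $\mathscr{P}\subseteq\mathbb{R}^n$, the Ehrhart polynomial $\operatorname{ehr}(\mathscr{P},t)$ is the unique polynomial with $\operatorname{ehr}(\mathscr{P},t)=\#(t\mathscr{P}\cap\mathbb{Z}^n)$ for all positive integers $t$. *)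

(* Defs.v *)
From HB Require Import structures.
From mathcomp Require Import all_boot all_order all_algebra.
From mathcomp Require Import all_classical all_reals.

Set Implicit Arguments.
Unset Strict Implicit.
Unset Printing Implicit Defensive.

Import Order.TTheory GRing.Theory Num.Theory.

Local Open Scope classical_set_scope.
Local Open Scope card_scope.
Local Open Scope ring_scope.

Definition prism_slice (R : realType) (n k : nat) (c : 'I_n -> nat) :
    set 'rV[R]_n :=
  [set x | (forall i, 0 <= x ord0 i <= (c i)%:R) /\
           \sum_(i < n) x ord0 i = k%:R].

Definition dilate (R : realType) (n t : nat) (P : set 'rV[R]_n) :
    set 'rV[R]_n :=
  [set t%:R *: x | x in P].

Definition lattice (R : realType) (n : nat) : set 'rV[R]_n :=
  [set x | forall i, x ord0 i \is a Num.int].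

Definition counts_lattice_points (R : realType) (n : nat)
    (P : set 'rV[R]_n) (p : {poly R}) : Prop :=
  forall t : nat, (0 < t)%N ->
    exists2 m : nat, dilate t P `&` @lattice R n #= `I_m & p.[t%:R] = m%:R.

Definition ehrhart_polynomial (R : realType) (n : nat)
    (P : set 'rV[R]_n) (p : {poly R}) : Prop :=
  unique (counts_lattice_points P) p.

(* Main.v *)
Require Import Defs.
From HB Require Import structures.
From mathcomp Require Import all_boot all_order all_algebra.
From mathcomp Require Import zify ring.
From mathcomp Require Import all_classical all_reals.

Set Implicit Arguments.
Unset Strict Implicit.
Unset Printing Implicit Defensive.

Import Order.TTheory GRing.Theory Num.Theory.

Local Open Scope classical_set_scope.
Local Open Scope card_scope.
Local Open Scope ring_scope.

(* Write n for the length of c. Inclusion-exclusion counts the lattice points of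
   t R_{k,c} as
     p(t) = 1/(n-1)! sum_{S : c(S) < k} (-1)^|S|
              prod_{0 < j < n} (t (k - c(S)) + j - |S|),
   so that (n-1)! [t^m] p is the coefficient of x^k in
     (sum_S (-1)^|S| x^(c(S)) [z^m] prod_{0 < j < n} (z + j - |S|))
       * sum_{j >= 1} j^m x^j.
   The second factor is x A_m(x) / (1 - x)^(m+1), with A_m the Eulerian polynomial.
   The first one is the sum over the permutations of {1, ..., n} with m + 1
   cycles of the product of 1 - x^(c(C)) over the cycles C, hence it is
   (1 - x)^(m+1) W(x) where W has nonnegative coefficients. The powers of 1 - x
   cancel, and W(x) x A_m(x) has positive coefficients in degrees 1, ...,
   c_1 + ... + c_n - 1. Permutations never appear explicitly: W is built by
   recursion on n, the last element being a fixed point or merged into a cycle. *)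

(** * Alternating sums over subsets, and merging of entries *)

(* The sum over all sets S of positions of c of (-1)^|S| f (c(S)) |S|, where
   c(S) is the sum of the entries of c at the positions in S. *)
Fixpoint altsum (V : zmodType) (c : seq nat) (f : nat -> nat -> V) : V :=
  if c is a :: c' then
    altsum c' f - altsum c' (fun u s => f (a + u)%N s.+1)
  else f 0 0.

(** Only pairs (c(S), |S|) occur, and |S| = 0 forces S to be empty, so c(S) = 0. [horner_count_poly]
    depends on this second fact. *)
Lemma eq_altsum (V : zmodType) (c : seq nat) (f g : nat -> nat -> V) :
  (forall u s, (s <= size c)%N -> (s = 0 -> u = 0)%N -> f u s = g u s) ->
  altsum c f = altsum c g.
Proof.
elim: c f g => [|a c IH] f g fg /=; first exact: fg.
congr (_ - _); apply: IH => u s sc su; apply: fg => //; exact: leqW.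
Qed.

Lemma altsumD (V : zmodType) (c : seq nat) (f g : nat -> nat -> V) :
  altsum c (fun u s => f u s + g u s) = altsum c f + altsum c g.
Proof.
elim: c f g => [|a c IH] f g //=.
by rewrite !IH opprD addrACA.
Qed.

Lemma altsum_morph (V W : zmodType) (h : V -> W) (c : seq nat)
    (f : nat -> nat -> V) : {morph h : x y / x - y} ->
  h (altsum c f) = altsum c (fun u s => h (f u s)).
Proof. by move=> hB; elim: c f => [|a c IH] f //=; rewrite hB !IH. Qed.

Lemma altsumB (V : zmodType) (c : seq nat) (f g : nat -> nat -> V) :
  altsum c f - altsum c g = altsum c (fun u s => f u s - g u s).
Proof.
rewrite (@altsum_morph _ _ -%R) -?altsumD // => x y.
by rewrite opprB opprK addrC.
Qed.

(** Summing t a + 1 over the entries a in S gives t c(S) + |S|; this is how |S| enters the count. *)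
Lemma altsum_map (V : zmodType) (t : nat) (c : seq nat) (g : nat -> V) :
  altsum [seq (t * a).+1 | a <- c] (fun u _ => g u) =
  altsum c (fun u s => g (t * u + s)%N).
Proof.
elim: c g => [|a c IH] g /=; first by rewrite muln0.
rewrite (IH g) (IH (fun u => g ((t * a).+1 + u)%N)); congr (_ - _).
by apply: eq_altsum => u s _ _; congr g; lia.
Qed.

(** Models inserting an element of weight [a] into a permutation right after another one: the two
    then act as a single element of weight [a + b]. *)
Fixpoint merges (a : nat) (c : seq nat) : seq (seq nat) :=
  if c is b :: c' then (a + b :: c')%N :: map (cons b) (merges a c') else [::].

Lemma merges_prop (a : nat) (c d : seq nat) : d \in merges a c ->
  [/\ size d = size c, sumn d = (a + sumn c)%N
    & all (leq 1) c -> all (leq 1) d].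
Proof.
elim: c d => [|b c IH] d //=.
rewrite in_cons => /orP[/eqP->|/mapP[e /IH[se me pe] ->]] /=.
  by split=> //; [rewrite addnA|move=> /andP[b0 ->]; rewrite andbT ltn_addl].
by split; [rewrite se|rewrite me addnCA|move=> /andP[-> /pe]].
Qed.

(** For a fixed S with s elements, the s merges at positions in S raise c(S) by [a], and the others
    leave it unchanged. *)
Lemma sum_altsum_merges (K : comNzRingType) (V : lmodType K) (a : nat)
    (c : seq nat) (f : nat -> nat -> V) :
  \sum_(d <- merges a c) altsum d f =
  altsum c (fun u s => ((size c)%:R - s%:R) *: f u s + s%:R *: f (a + u)%N s).
Proof.
elim: c f => [|b c IH] f /=.
  by rewrite big_nil subrr !scale0r addr0.
rewrite big_cons big_map /= sumrB (IH f).
rewrite (IH (fun u s => f (b + u)%N s.+1)).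
rewrite addrACA -opprD -!altsumD; congr (_ - _); apply: eq_altsum => u s _ _.
  by rewrite -natr1 addrAC [in RHS]scalerDl scale1r addrA [f u s + _]addrC.
rewrite (_ : (size c).+1%:R - s.+1%:R = (size c)%:R - s%:R :> K); last first.
  by rewrite -!natr1; ring.
rewrite -[s.+1%:R]natr1 (scalerDl _ s%:R 1) scale1r addrA [LHS]addrC.
by rewrite -(addnA a b u) (addnCA b a u) addrA addrC.
Qed.

(** * Rising and falling factorial polynomials *)

(** Up to the sign (-1)^s, this is the sum of (-1)^(number of cycles inside S) z^(number of cycles)
    over the permutations of n elements that preserve a given set S of size s. *)
Definition fall_rise (R : nzRingType) (n s : nat) : {poly R} :=
  (\prod_(0 <= i < s) ('X - i%:R%:P)) * (\prod_(0 <= i < n - s) ('X + i%:R%:P)).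

Lemma fall_rise_rise (R : comNzRingType) (n s : nat) : (s <= n)%N ->
  fall_rise R n.+1 s = fall_rise R n s * ('X + (n%:R - s%:R)%:P).
Proof.
by move=> sn; rewrite /fall_rise subSn // big_nat_recr //= mulrA natrB.
Qed.

Lemma fall_rise_fall (R : comNzRingType) (n s : nat) :
  fall_rise R n.+1 s.+1 = fall_rise R n s * ('X - s%:R%:P).
Proof.
by rewrite /fall_rise subSS [in LHS]big_nat_recr //= mulrAC.
Qed.

(** This is (n-1)! times the binomial coefficient C(z - s + n - 1, n - 1), as a polynomial in z. *)
Definition shifted_rise (R : nzRingType) (n s : nat) : {poly R} :=
  \prod_(1 <= j < n) ('X + (j%:R - s%:R)%:P).

Lemma fall_rise_diag (R : comNzRingType) (n : nat) : (0 < n)%N ->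
  fall_rise R n n = shifted_rise R n n * 'X.
Proof.
move=> n0; rewrite /fall_rise subnn [X in _ * X]big_nil mulr1 big_ltn //.
rewrite subr0 mulrC; congr (_ * _); rewrite /shifted_rise big_nat_rev /=.
apply: eq_big_nat => i /andP[i1 iN].
rewrite (_ : 1 + n - i.+1 = n - i)%N; last by lia.
by rewrite natrB 1?ltnW // !polyCB; ring.
Qed.

(** Both sides have factors from z - s + 1 to z + n - s - 1, and the left one has z once more than
    [shifted_rise]. This extra ['X] shifts m to m + 1 in [coef_fall_rise]. *)
Lemma fall_riseE (R : comNzRingType) (n s : nat) : (0 < n)%N -> (s <= n)%N ->
  fall_rise R n s = shifted_rise R n s * 'X.
Proof.
elim: n => // n IH _; rewrite leq_eqVlt => /predU1P[->|].
  exact: fall_rise_diag.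
rewrite ltnS => sn; rewrite fall_rise_rise //.
case: n IH sn => [|n] IH sn.
  move: sn; rewrite leqn0 => /eqP->.
  by rewrite /fall_rise /shifted_rise !big_nil !mul1r subrr addr0.
by rewrite IH // /shifted_rise [in RHS]big_nat_recr //= mulrAC.
Qed.

Lemma size_shifted_rise (R : idomainType) (n s : nat) : (0 < n)%N ->
  size (shifted_rise R n s) = n.
Proof.
case: n => // n _.
rewrite /shifted_rise (eq_bigr (fun j : nat => 'X - (s%:R - j%:R)%:P)); last first.
  by move=> i _; rewrite -polyCN opprB.
by rewrite size_prod_XsubC size_iota subSS subn0.
Qed.

Lemma coef_fall_rise (R : idomainType) (n s m : nat) : (0 < n)%N ->
  (s <= n)%N -> (fall_rise R n s)`_m.+1 = (shifted_rise R n s)`_m.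
Proof. by move=> n0 sn; rewrite fall_riseE // coefMX. Qed.

(** * Cycle polynomials and their quotients by powers of 1 - X *)

(* This is the coefficient of z^m in the sum over all
   permutations of {1, ..., n} of the product over their cycles C of
   z (1 - X^(c(C))). *)
Definition cycle_poly (R : nzRingType) (c : seq nat) (m : nat) : {poly R} :=
  altsum c (fun u s => (fall_rise R (size c) s)`_m *: 'X^u).

(* Deleting one element, which is either a fixed point or follows another
   element in its cycle. *)
Lemma cycle_poly_cons (R : comNzRingType) (a : nat) (c : seq nat) (m : nat) :
  cycle_poly R (a :: c) m =
  (if m is m'.+1 then (1 - 'X^a) * cycle_poly R c m' else 0)
  + \sum_(d <- merges a c) cycle_poly R d m.
Proof.
rewrite (eq_big_seq (fun d => altsum d
    (fun u s => (fall_rise R (size c) s)`_m *: 'X^u))); last first.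
  by move=> d /merges_prop[sd _ _]; rewrite /cycle_poly sd.
rewrite sum_altsum_merges /cycle_poly /=.
have -> : (if m is m'.+1 then (1 - 'X^a) *
      altsum c (fun u s => (fall_rise R (size c) s)`_m' *: 'X^u) else 0) =
    altsum c (fun u s => (if m is m'.+1 then (fall_rise R (size c) s)`_m'
      else 0) *: 'X^u - (if m is m'.+1 then (fall_rise R (size c) s)`_m'
      else 0) *: 'X^(a + u)).
  case: m => [|m].
    transitivity (altsum c (fun _ _ => 0 : {poly R})).
      by elim: (c) => //= _ e <-; rewrite subrr.
    by apply: eq_altsum => u s _ _; rewrite !scale0r subrr.
  rewrite (@altsum_morph _ _ ( *%R (1 - 'X^a))); last exact: mulrBr.
  apply: eq_altsum => u s _ _ /=; rewrite mulrBl mul1r exprD.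
  by rewrite -scalerAr.
rewrite -altsumD altsumB; apply: eq_altsum => u s sc _.
rewrite fall_rise_rise // fall_rise_fall !mulrDr mulrN !coefD coefN !coefMX !coefMC.
set x := (if m is 0 then _ else _).
rewrite (_ : (if (m == 0)%N then 0 else (fall_rise R (size c) s)`_m.-1) = x);
  last by rewrite /x; case: (m).
by rewrite !scalerA -!mul_polyC !(polyCD, polyCN, polyCM); ring.
Qed.

(** The recursion of [cycle_poly_cons] with [1 - 'X^a] divided by [1 - 'X]. The fuel [n] stands for
    the length of [c], since merged lists are not subterms. *)
Fixpoint cycle_weight (R : nzRingType) (n : nat) (c : seq nat) (m : nat) :
    {poly R} :=
  match n, c with
  | n'.+1, a :: c' =>
    (if m is m'.+1 then (\sum_(i < a) 'X^i) * cycle_weight R n' c' m' else 0)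
    + \sum_(d <- merges a c') cycle_weight R n' d m
  | _, _ => (m == 0)%:R
  end.

Lemma cycle_polyE (R : comNzRingType) (n : nat) (c : seq nat) (m : nat) :
  size c = n -> cycle_poly R c m = (1 - 'X) ^+ m * cycle_weight R n c m.
Proof.
elim: n c m => [|n IH] [|a c] m // => [_|[sc]].
  rewrite /cycle_poly /= /fall_rise !big_nil mulr1 expr0 coef1.
  by case: m => [|m]; rewrite ?mulr1 ?scale1r ?mulr0 ?scale0r.
rewrite cycle_poly_cons /= mulrDr mulr_sumr; congr (_ + _).
  case: m => [|m]; first by rewrite mulr0.
  by rewrite IH // -opprB subrX1 -mulNr opprB exprS mulrACA.
by apply: eq_big_seq => d /merges_prop[sd _ _]; rewrite IH // sd.
Qed.

Lemma coefM_gt0 (R : numDomainType) (p q : {poly R}) (i j : nat) :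
  (forall l, 0 <= p`_l) -> (forall l, 0 <= q`_l) ->
  0 < p`_i -> 0 < q`_j -> 0 < (p * q)`_(i + j).
Proof.
move=> p0 q0 pi qj; rewrite coefM.
have ij : (i < (i + j).+1)%N by rewrite ltnS leq_addr.
rewrite (bigD1 (Ordinal ij)) //= addKn ltr_wpDr ?mulr_gt0 //.
by apply: sumr_ge0 => l _; apply: mulr_ge0.
Qed.

Lemma coef_sumXn (R : nzRingType) (a i : nat) :
  (\sum_(j < a) 'X^j : {poly R})`_i = (i < a)%:R.
Proof.
rewrite (eq_bigr (fun j : 'I_a => 1 *: 'X^j)) => [|j _]; last by rewrite scale1r.
by rewrite -(poly_def _ (fun=> 1)) coef_poly; case: ifP.
Qed.

Lemma cycle_weight_ge0 (R : numDomainType) (n : nat) (c : seq nat) (m i : nat) :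
  0 <= (cycle_weight R n c m)`_i.
Proof.
elim: n c m i => [|n IH] c m i /=.
  by case: m => [|m] /=; rewrite ?coef1 ?coef0 //; case: i.
case: c => [|a c]; first by case: m => [|m] /=; rewrite ?coef1 ?coef0 //; case: i.
rewrite coefD coef_sum addr_ge0 ?sumr_ge0 //.
case: m => [|m]; first by rewrite coef0.
rewrite coefM; apply: sumr_ge0 => j _.
by rewrite mulr_ge0 ?coef_sumXn.
Qed.

Lemma size_le_sumn (c : seq nat) : all (leq 1) c -> (size c <= sumn c)%N.
Proof. by elim: c => //= a c IH /andP[a0 /IH]; lia. Qed.

(** With as many cycles as elements, the fixed-point term is positive. With fewer, merging the first
    two elements suffices: it keeps the sum and shortens the list. *)
Lemma cycle_weight_gt0 (R : numDomainType) (n : nat) (c : seq nat) (m i : nat) :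
  size c = n -> all (leq 1) c -> (m <= n)%N -> ((0 < m) || (n == 0))%N ->
  (i + m <= sumn c)%N -> 0 < (cycle_weight R n c m)`_i.
Proof.
elim: n c m i => [|n IH] [|a c] m i //.
  by move=> _ _; rewrite leqn0 => /eqP-> _; case: i => // _; rewrite coef1.
move=> [sc] /andP[a0 c0]; rewrite orbF leq_eqVlt => /predU1P[->|mn] m0 im /=.
  rewrite coefD coef_sum ltr_wpDr ?sumr_ge0 // => [j _|].
    exact: cycle_weight_ge0.
  (* The geometric sum takes as much of the degree as it can, at most a - 1, so that the rest stays
     within the bound for [c]. *)
  rewrite (_ : i = (minn i a.-1 + (i - minn i a.-1))%N); last by lia.
  apply: coefM_gt0 => [l|l||]; rewrite ?coef_sumXn ?cycle_weight_ge0 //.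
    by rewrite (_ : (_ < a)%N) //; lia.
  apply: IH => //; first by case: (n).
  by have := size_le_sumn c0; move: im => /=; rewrite sc; lia.
case: c sc im c0 => [|b c] sc im c0; first by move: mn m0; rewrite -sc; case: m {im}.
rewrite coefD ltr_wpDl //.
  case: m {mn m0 im} => [|m]; first by rewrite coef0.
  rewrite coefM; apply: sumr_ge0 => j _.
  by rewrite mulr_ge0 ?coef_sumXn ?cycle_weight_ge0.
rewrite [merges _ _]/= big_cons coefD coef_sum ltr_wpDr ?sumr_ge0 //.
  by move=> j _; exact: cycle_weight_ge0.
apply: IH => //.
- by have /andP[_ c1] := c0; apply/andP; split; [lia|exact: c1].
- by rewrite m0.

by move: im => /=; lia.
Qed.

(** * Eulerian numbers and positivity of the coefficients *)

(* The coefficient of X^k in the product of q by the power series of the j^m,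
   j >= 1; the latter equals X A_m / (1 - X)^(m+1), A_m the Eulerian polynomial. *)
Definition power_conv (R : nzRingType) (m k : nat) (q : {poly R}) : R :=
  \sum_(0 <= i < k) q`_i * (k - i)%:R ^+ m.

Lemma power_convB (R : nzRingType) (m k : nat) :
  {morph @power_conv R m k : p q / p - q}.
Proof.
move=> p q; rewrite /power_conv -sumrB; apply: eq_bigr => i _.
by rewrite coefB mulrBl.
Qed.

Lemma power_convZ (R : nzRingType) (m k : nat) (a : R) (q : {poly R}) :
  power_conv m k (a *: q) = a * power_conv m k q.
Proof.
rewrite /power_conv mulr_sumr; apply: eq_bigr => i _.
by rewrite coefZ mulrA.
Qed.

Lemma power_conv_sum (R : nzRingType) (m k n : nat) (F : 'I_n -> {poly R}) :
  power_conv m k (\sum_(j < n) F j) = \sum_(j < n) power_conv m k (F j).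
Proof.
rewrite /power_conv exchange_big /=; apply: eq_bigr => i _.
by rewrite coef_sum mulr_suml.
Qed.

Lemma power_convMXn (R : nzRingType) (m k j : nat) (q : {poly R}) :
  power_conv m k (q * 'X^j) = power_conv m (k - j) q.
Proof.
rewrite /power_conv; case: (leqP k j) => kj.
  rewrite (eqP kj) [RHS]big_nil big_nat big1 // => i ik.
  by rewrite coefMXn ifT ?mul0r //; lia.
rewrite (big_cat_nat _ (ltnW kj)) //= big_nat big1 ?add0r => [|i ij]; last first.
  by rewrite coefMXn ifT ?mul0r //; lia.
rewrite -{1}[j]add0n big_addn; apply: eq_bigr => i _.
by rewrite coefMXn ifF ?addnK; [congr (_ * _%:R ^+ _); lia|lia].
Qed.

Lemma power_convM (R : comNzRingType) (m k : nat) (p q : {poly R}) :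
  power_conv m k (p * q) =
  \sum_(j < size q) q`_j * power_conv m (k - j) p.
Proof.
rewrite -{1}[q]coefK poly_def mulr_sumr power_conv_sum; apply: eq_bigr => j _.
by rewrite -scalerAr power_convZ power_convMXn.
Qed.

Definition eulerian (R : nzRingType) (m k : nat) : R :=
  power_conv m k ((1 - 'X) ^+ m.+1).

Lemma eulerian0 (R : nzRingType) (k : nat) : eulerian R 0 k = (k == 1)%:R.
Proof.
rewrite /eulerian /power_conv expr1; case: k => [|[|k]].
- by rewrite big_nil.
- by rewrite big_nat1 coefB coef1 coefX subr0 mulr1.
rewrite 2?big_ltn // big_nat big1 => [|i /andP[i2 _]].
  by rewrite !coefB !coef1 !coefX /= !mulr1 subr0 sub0r addr0 subrr.
by rewrite coefB coef1 coefX; case: i i2 => [|[|i]] //= _; rewrite subrr mul0r.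
Qed.

(** Combines [E1], from (1-x)^(m+2) = (1-x) (1-x)^(m+1), with [E2], from the derivative of
    (1-x)^(m+2). It yields the Eulerian recurrence term by term. *)
Lemma coef_1subX_exp (R : comNzRingType) (m i k : nat) :
  (k%:R - i%:R) * ((1 - 'X) ^+ m.+2)`_i.+1 =
  k.+1%:R * ((1 - 'X) ^+ m.+1)`_i.+1
  + (m.+1%:R - k%:R) * ((1 - 'X) ^+ m.+1)`_i :> R.
Proof.
have E1 : ((1 - 'X) ^+ m.+2)`_i.+1 =
    ((1 - 'X) ^+ m.+1)`_i.+1 - ((1 - 'X) ^+ m.+1)`_i :> R.
  by rewrite exprS mulrBl mul1r coefB coefXM.
have E2 : ((1 - 'X) ^+ m.+2)`_i.+1 * i.+1%:R =
    - (m.+2%:R * ((1 - 'X) ^+ m.+1)`_i) :> R.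
  rewrite mulr_natr -coef_deriv deriv_exp derivB derivX derivC sub0r mulN1r.
  by rewrite mulNrn coefN coefMn mulr_natl.
transitivity (k.+1%:R * ((1 - 'X) ^+ m.+2)`_i.+1
    - ((1 - 'X) ^+ m.+2)`_i.+1 * i.+1%:R : R).
  by rewrite -!natr1; ring.
by rewrite E2 E1 -!natr1; ring.
Qed.

Lemma eulerianS (R : comNzRingType) (m k : nat) :
  eulerian R m.+1 k.+1 =
  k.+1%:R * eulerian R m k.+1 + (m.+1%:R - k%:R) * eulerian R m k.
Proof.
have coef0_exp l : ((1 - 'X) ^+ l)`_0 = 1 :> R.
  by rewrite -horner_coef0 horner_exp !hornerE subr0 expr1n.
rewrite /eulerian /power_conv !big_nat_recl //= mulrDr -addrA.
congr (_ + _); first by rewrite !coef0_exp !mul1r exprS subn0.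
rewrite !mulr_sumr -big_split /= !big_nat; apply: eq_bigr => i /andP[_ ik].
rewrite subSS [_%:R ^+ m.+1]exprS natrB 1?ltnW // mulrCA [LHS]mulrA.
by rewrite coef_1subX_exp; ring.
Qed.

(** The vanishing clause is carried along because the factor m + 1 - k of the recurrence is negative
    for k > m + 1. *)
Lemma eulerian_ge0_gt0 (R : numDomainType) (m k : nat) :
  [/\ 0 <= eulerian R m k, (m.+1 < k)%N -> eulerian R m k = 0
    & (0 < k <= maxn m 1)%N -> 0 < eulerian R m k].
Proof.
elim: m k => [|m IH] k.
  rewrite eulerian0; split=> //; first by case: k => [|[]].
  by case: k => [|[]].
case: k => [|k]; first by rewrite /eulerian /power_conv big_nil.
have [a0 az ap] := IH k.+1; have [b0 bz bp] := IH k; rewrite eulerianS.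
have h0 : 0 <= (m.+1%:R - k%:R) * eulerian R m k.
  case: (leqP k m.+1) => km; last by rewrite bz // mulr0.
  by rewrite mulr_ge0 // subr_ge0 ler_nat.
split=> [|km|km]; first by apply: addr_ge0 => //; rewrite mulr_ge0 ?ler0n.
  rewrite az ?mulr0 ?add0r; last by lia.
  case: (ltnP m.+1 k) => km'; first by rewrite bz // mulr0.
  by rewrite (_ : k = m.+1) ?subrr ?mul0r //; lia.
case: (leqP k.+1 (maxn m 1)) => km1.
  by rewrite ltr_wpDr // mulr_gt0 ?ltr0n // ap.
rewrite ltr_wpDl ?mulr_ge0 ?ler0n // mulr_gt0 //; last by apply: bp; lia.
by rewrite subr_gt0 ltr_nat; lia.
Qed.

Lemma power_conv_cycle_poly_gt0 (R : numDomainType) (c : seq nat) (m k : nat) :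
  all (leq 1) c -> (m < size c)%N -> (0 < k < sumn c)%N ->
  0 < power_conv m k (cycle_poly R c m.+1).
Proof.
move=> c0 mc kc; rewrite (cycle_polyE _ _ (erefl _)) power_convM.
set W := cycle_weight _ _ _ _.
(* With truncated subtraction, k - j is 1 if m = 0 and min(k, m) otherwise, where the Eulerian
   number is positive. Also j + m + 1 is at most [sumn c], because k < [sumn c] and m < [size c],
   which is at most [sumn c]. *)
pose j := if m == 0 then k.-1 else (k - m)%N.
have Wj : 0 < W`_j.
  apply: cycle_weight_gt0 => //.
  by have := size_le_sumn c0; rewrite /j; case: eqP; lia.
have jW : (j < size W)%N.
  by rewrite ltnNge; apply: contraTN Wj => Wj; rewrite nth_default // ltxx.
rewrite (bigD1 (Ordinal jW)) //= ltr_wpDr //.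
  apply: sumr_ge0 => i _; rewrite mulr_ge0 ?cycle_weight_ge0 //.
  by have [] := eulerian_ge0_gt0 R m (k - i).
rewrite mulr_gt0 //; have [_ _] := eulerian_ge0_gt0 R m (k - j).
by apply; rewrite /j; case: eqP; lia.
Qed.

Definition count_poly (R : fieldType) (c : seq nat) (k : nat) : {poly R} :=
  ((size c).-1)`!%:R^-1 *:
  altsum c (fun u s => if (u < k)%N then
    shifted_rise R (size c) s \Po ((k - u)%:R *: 'X) else 0).

Lemma coef_comp_polyZX (R : comNzRingType) (p : {poly R}) (a : R) (m : nat) :
  (p \Po (a *: 'X))`_m = p`_m * a ^+ m.
Proof.
rewrite coef_comp_poly.
under eq_bigr do rewrite exprZn coefZ coefXn.
case: (ltnP m (size p)) => mp; last first.
  rewrite nth_default // mul0r big1 // => i _.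
  by rewrite (_ : (m == i) = false) ?mulr0 //; have := ltn_ord i; lia.
rewrite (bigD1 (Ordinal mp)) //= eqxx mulr1 big1 ?addr0 // => i im.
by rewrite (_ : (m == i) = false) ?mulr0 // eq_sym; apply: negbTE.
Qed.

(** Substituting (k - u) z for z multiplies the coefficient of z^m by (k - u)^m, which is
    [power_conv] of ['X^u] if u < k; for u >= k both sides are 0. *)
Lemma coef_count_poly (R : fieldType) (c : seq nat) (k m : nat) :
  (0 < size c)%N ->
  (count_poly R c k)`_m =
  ((size c).-1)`!%:R^-1 * power_conv m k (cycle_poly R c m.+1).
Proof.
move=> c0; rewrite coefZ; congr (_ * _).
rewrite (@altsum_morph _ _ (fun p : {poly R} => p`_m)); last first.
  by move=> p q; rewrite coefB.
rewrite (altsum_morph _ _ (@power_convB R m k)); apply: eq_altsum => u s sc _.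
rewrite power_convZ coef_fall_rise // -['X^u]mul1r power_convMXn.
case: ifP => uk; last first.
  by rewrite coef0 /power_conv (_ : k - u = 0)%N ?big_nil ?mulr0 //; lia.
rewrite coef_comp_polyZX; congr (_ * _); rewrite /power_conv.
rewrite big_ltn ?subn_gt0 // coef1 mul1r subn0 big_nat big1 ?addr0 // => i i0.
by rewrite coef1; case: i i0 => //= i _; rewrite mul0r.
Qed.

Lemma count_poly_gt0 (R : numFieldType) (c : seq nat) (k m : nat) :
  all (leq 1) c -> (m < size c)%N -> (0 < k < sumn c)%N ->
  0 < (count_poly R c k)`_m.
Proof.
move=> c0 mc kc; rewrite coef_count_poly ?(leq_ltn_trans _ mc) //.
by rewrite mulr_gt0 ?power_conv_cycle_poly_gt0 // invr_gt0 ltr0n fact_gt0.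
Qed.

Lemma size_count_poly (R : numFieldType) (c : seq nat) (k : nat) :
  all (leq 1) c -> (0 < k < sumn c)%N -> size (count_poly R c k) = size c.
Proof.
move=> c0 kc; have s0 : (0 < size c)%N by case: c c0 kc => //= _; case: k.
apply/eqP; rewrite eqn_leq; apply/andP; split.
  apply/leq_sizeP => m cm; rewrite coefZ.
  rewrite (@altsum_morph _ _ (fun p : {poly R} => p`_m)); last first.
    by move=> p q; rewrite coefB.
  rewrite (@eq_altsum _ _ _ (fun _ _ => 0)) => [|u s _ _].
    by elim: (c) => [|a d] /=; rewrite ?mulr0 // subrr mulr0.
  case: ifP => _; rewrite ?coef0 // coef_comp_polyZX nth_default ?mul0r //.
  by rewrite size_shifted_rise.
rewrite leqNgt; apply/negP => sp.
have : 0 < (count_poly R c k)`_(size c).-1 by apply: count_poly_gt0 => //; lia.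
by rewrite nth_default ?ltxx // -ltnS prednK.
Qed.

(** * Counting bounded tuples by inclusion-exclusion *)

(* The number of n-tuples of naturals with sum K - e. *)
Definition multichoose (n K e : nat) : nat :=
  if (e <= K)%N then
    if n is n'.+1 then 'C(K - e + n', n') else nat_of_bool (K == e)
  else 0.

(** Either the first entry is 0, or it can be lowered by 1. The sum over j < b in [coef_prod_sumXn]
    telescopes by this. *)
Lemma multichooseS (n K e : nat) :
  multichoose n.+1 K e = (multichoose n K e + multichoose n.+1 K e.+1)%N.
Proof.
rewrite /multichoose; case: (ltngtP e K) => [eK|//|->]; last first.
  by case: n => [|n]; rewrite subnn ?eqxx !add0n ?binn.
case: n => [|n]; first by rewrite !bin0.
rewrite subnS; have: (0 < K - e)%N by rewrite subn_gt0.
by case: (K - e)%N => // M _; rewrite addnS binS addnC [X in (_ + 'C(X, _))%N]addSnnS.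
Qed.

Lemma altsum_sum (V : zmodType) (b : nat) (c : seq nat)
    (f : nat -> nat -> nat -> V) :
  \sum_(j < b) altsum c (f j) = altsum c (fun u s => \sum_(j < b) f j u s).
Proof.
elim: c f => [|a c IH] f //=.
by rewrite sumrB (IH f) (IH (fun j u s => f j (a + u)%N s.+1)).
Qed.

(** Inclusion-exclusion on the entries that reach their bound; ['X^d] carries the exponents already
    chosen through the induction. *)
Lemma coef_prod_sumXn (R : comNzRingType) (bs : seq nat) (K d : nat) :
  ('X^d * \prod_(b <- bs) \sum_(j < b) 'X^j : {poly R})`_K =
  altsum bs (fun u _ => (multichoose (size bs) K (d + u))%:R).
Proof.
elim: bs d => [|b bs IH] d.
  rewrite big_nil mulr1 coefXn /= addn0 /multichoose.
  by case: (ltngtP d K).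
rewrite big_cons mulrA mulr_sumr mulr_suml coef_sum /=.
under eq_bigr => j _ do rewrite -exprD IH.
rewrite (altsum_sum b bs (fun j u _ => (multichoose (size bs) K (d + j + u))%:R)).
rewrite altsumB; apply: eq_altsum => u _ _ _.
elim: b => [|b IHb]; first by rewrite big_ord0 add0n subrr.
rewrite big_ord_recr /= IHb addSn addnS addnA.
by rewrite (multichooseS _ _ (d + b + u)) natrD; ring.
Qed.

Lemma horner_shifted_rise (R : numFieldType) (n s y : nat) :
  (0 < y)%N -> (0 < n)%N -> (s <= n)%N ->
  (n.-1)`!%:R^-1 * (shifted_rise R n s).[y%:R] =
  if (s <= y)%N then 'C(y - s + n.-1, n.-1)%:R else 0.
Proof.
move=> y0 n0 sn; rewrite /shifted_rise horner_prod.
rewrite (eq_bigr (fun j : nat => y%:R + j%:R - s%:R)) => [|j _]; last first.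
  by rewrite hornerD hornerX hornerC addrA.
case: leqP => sy; last first.
  (* The factor at j = s - y is zero, and 0 < j < n because 0 < y < s <= n. *)
  rewrite (bigD1_seq (s - y)%N) ?iota_uniq //=; last by rewrite mem_index_iota; lia.
  by rewrite -natrD subnKC 1?ltnW // subrr mul0r mulr0.
have -> : \prod_(1 <= j < n) (y%:R + j%:R - s%:R) =
   ((y - s + n.-1) ^_ n.-1)%:R :> R.
  rewrite ffact_prod natr_prod -(prednK n0) big_add1 /= big_nat_rev /= big_mkord.
  apply: eq_bigr => i _; have := ltn_ord i => iN.
  rewrite add0n (_ : y - s + n.-1 - i = y + (n.-1 - i.+1).+1 - s)%N; last by lia.
  by rewrite natrB ?natrD //; lia.
by rewrite -bin_ffact natrM mulrC mulfK // pnatr_eq0 -lt0n fact_gt0.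
Qed.

Lemma horner_count_poly (R : numFieldType) (c : seq nat) (k t : nat) :
  (0 < size c)%N -> (0 < k)%N -> (0 < t)%N ->
  (count_poly R c k).[t%:R] =
  (\prod_(a <- c) \sum_(j < (t * a).+1) 'X^j : {poly R})`_(t * k).
Proof.
move=> c0 k0 t0; rewrite -[in RHS](big_map (fun a => (t * a).+1) xpredT
  (fun b => \sum_(j < b) 'X^j)) -[\prod_(_ <- _) _]mul1r -(expr0 'X).
rewrite coef_prod_sumXn size_map.
rewrite (altsum_map t c (fun u => (multichoose (size c) (t * k) (0 + u))%:R)).
rewrite hornerZ (@altsum_morph _ _ (fun p : {poly R} => p.[t%:R])); last first.
  by move=> p q; rewrite hornerD hornerN.
rewrite (@altsum_morph _ _ ( *%R _)); last exact: mulrBr.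
apply: eq_altsum => u s sc su; rewrite add0n /multichoose.
rewrite -{3}(prednK c0); case: ltnP => uk; last first.
  rewrite hornerE mulr0; case: leqP => // h.
  (* For u >= k > 0 the set is nonempty, so t u + s > t k: the sets left out of [count_poly] admit
     no tuple. *)
  have [u0|tu] : (u = 0 \/ t * k < t * u + s)%N.
  - case: s sc su h => [|s] _ su h; first by left; exact: su.
    by right; nia.
  - by rewrite u0 in uk; lia.
  by lia.
rewrite horner_comp !hornerE -natrM mulnC horner_shifted_rise //; last first.
  by rewrite muln_gt0 t0 subn_gt0.
rewrite mulnBr -leq_subRL; last by rewrite leq_pmul2l // ltnW.
by case: leqP => // h; rewrite subnDA.
Qed.

(** * From bounded tuples to lattice points of the dilated slice *)

(** Expanding the product picks an exponent below [b i] for each i; [M] provides a common finite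
    codomain. *)
Lemma card_bounded_ffun (R : comNzRingType) (n M K : nat) (b : 'I_n -> nat) :
  (forall i, b i <= M)%N ->
  (\prod_i \sum_(j < b i) 'X^j : {poly R})`_K =
  #|[set f : {ffun 'I_n -> 'I_M} | [forall i, f i < b i]%N &
      (\sum_i f i == K)%N]|%:R.
Proof.
move=> bM.
under eq_bigr => i _ do rewrite (big_ord_widen _ (fun j => 'X^j) (bM i)).
rewrite (bigA_distr_big_dep (fun i (j : 'I_M) => (j < b i)%N)).
rewrite coef_sum -sum1_card natr_sum big_mkcond [RHS]big_mkcond /=.
apply: eq_bigr => f _; rewrite [X in _ = if X then _ else _]inE.
rewrite [X in (if X then _ else _) = _](_ : _ = [forall i, f i < b i]%N) //.
case: ifP => //= _; rewrite -(big_morph _ (exprD 'X) (expr0 'X)) coefXn eq_sym.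
by case: eqP.
Qed.

Lemma card_eq_seq (T : choiceType) (s : seq T) : uniq s ->
  [set x | x \in s] #= `I_(size s).
Proof.
case: s => [|x0 s'] us.
  by rewrite (_ : [set x | x \in [::]] = set0) ?II0 //; apply/seteqP; split.
set s := x0 :: s' in us *.
have <- : nth x0 s @` `I_(size s) = [set x | x \in s].
  apply/seteqP; split=> x /=; first by move=> [i ilt <-]; apply: mem_nth.
  by move=> xs; exists (index x s); [rewrite /mkset index_mem|rewrite nth_index].
apply: inj_card_eq => i j; rewrite !inE /= => i_s j_s /eqP.
by rewrite nth_uniq // => /eqP.
Qed.

Lemma card_lattice_points (R : realType) (n k t : nat) (c : 'I_n -> nat) :
  (0 < t)%N ->
  exists2 m : nat, dilate t (@prism_slice R n k c) `&` @lattice R n #= `I_m &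
    (\prod_i \sum_(j < (t * c i).+1) 'X^j : {poly R})`_(t * k) = m%:R.
Proof.
move=> t0; pose M := \max_i (t * c i).+1.
have bM i : ((t * c i).+1 <= M)%N by apply: leq_bigmax.
rewrite (card_bounded_ffun _ _ bM).
set A := [set f | _ & _]%SET; exists #|A| => //.
pose v (f : {ffun 'I_n -> 'I_M}) : 'rV[R]_n := \row_i (f i)%:R.
have v_inj : injective v.
  move=> f g /rowP fg; apply/ffunP => i; apply/val_inj => /=.
  by have := fg i; rewrite !mxE => /eqP; rewrite eqr_nat => /eqP.
suff -> : dilate t (@prism_slice R n k c) `&` @lattice R n =
    [set x | x \in [seq v f | f <- enum A]].
  by rewrite cardE -(size_map v); apply: card_eq_seq; rewrite map_inj_uniq ?enum_uniq.
have t0R : (t%:R : R) != 0 by rewrite pnatr_eq0 -lt0n.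
apply/seteqP; split=> [y [[x [x0c xk] <-] yint]|y /mapP[f fA ->]].
- have natx i : exists l : nat, t%:R * x ord0 i = l%:R.
    apply/natrP; rewrite natrEint; have := yint i; rewrite mxE => -> /=.
    by have /andP[x0 _] := x0c i; rewrite mulr_ge0.
  pose l i := projT1 (cid (natx i)).
  have lE i : t%:R * x ord0 i = (l i)%:R by rewrite /l; case: cid.
  have lb i : (l i < (t * c i).+1)%N.
    rewrite ltnS -(ler_nat R) -lE natrM ler_wpM2l //.
    by have /andP[] := x0c i.
  apply/mapP; exists [ffun i => Ordinal (leq_trans (lb i) (bM i))].
    rewrite mem_enum inE; apply/andP; split.
      by apply/forallP => i; rewrite ffunE; exact: lb.
    rewrite -(eqr_nat R) natr_sum; under eq_bigr => i _ do rewrite ffunE /= -lE.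
    by rewrite -mulr_sumr xk natrM.
  by apply/rowP => i; rewrite !mxE ffunE /= lE.
move: fA; rewrite mem_enum inE => /andP[/forallP fb /eqP fk]; split; last first.
  by move=> i; rewrite mxE intr_nat.
exists (t%:R^-1 *: v f); last by rewrite scalerA mulfV // scale1r.
split=> [i|].
  rewrite !mxE mulr_ge0 ?invr_ge0 //= ler_pdivrMl ?ltr0n // -natrM ler_nat.
  exact: fb.
under eq_bigr do rewrite !mxE.
by rewrite -mulr_sumr -natr_sum fk natrM mulKf.
Qed.

Lemma poly_eq_on_posnat (R : numDomainType) (p q : {poly R}) :
  (forall t : nat, (0 < t)%N -> p.[t%:R] = q.[t%:R]) -> p = q.
Proof.
move=> pq; apply/eqP; rewrite -subr_eq0; apply/eqP.
apply: (@roots_geq_poly_eq0 _ _ [seq i.+1%:R | i <- iota 0 (size (p - q))]).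
- by apply/allP => _ /mapP[i _ ->]; rewrite rootE !hornerE pq ?subrr.
- rewrite map_inj_uniq ?iota_uniq // => i j /eqP.
  by rewrite eqr_nat eqSS => /eqP.
- by rewrite size_map size_iota.
Qed.

Theorem theorem1p1 (R : realType) (n : nat) (c : 'I_n -> nat) (k : nat) :
  (1 <= n)%N ->
  (forall i, (0 < c i)%N) ->
  (0 < k < \sum_(i < n) c i)%N ->
  exists p : {poly R},
    [/\ ehrhart_polynomial (@prism_slice R n k c) p,
        size p = n
      & forall i : nat, (i < n)%N -> 0 < p`_i].
Proof.
move=> n0 c0 kc; set cs := [seq c i | i <- enum 'I_n].
have size_cs : size cs = n by rewrite size_map size_enum_ord.
have cs0 : all (leq 1) cs by apply/allP => _ /mapP[i _ ->]; apply: c0.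
have kcs : (0 < k < sumn cs)%N by rewrite sumnE big_map big_enum.
exists (count_poly R cs k); split.
- have count : counts_lattice_points (@prism_slice R n k c) (count_poly R cs k).
    move=> t t0; have [m Sm mE] := card_lattice_points R k c t0.
    exists m => //; rewrite horner_count_poly ?size_cs //; last by case/andP: kc.
    by rewrite big_map big_enum -mE.
  (* Uniqueness: at each t > 0 both polynomials give the cardinality of the same set. *)
  split=> // q qcount; apply: poly_eq_on_posnat => t t0.
  have [m Sm ->] := count t t0; have [l Sl ->] := qcount t t0.
  congr _%:R; apply/card_eq_II; apply: card_eq_trans Sl.
  exact: card_esym.
- by rewrite size_count_poly.
- by move=> i i_n; rewrite count_poly_gt0 ?size_cs.
Qed.
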